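(* Let $G$ be a finite $2$-group, and let $A$ be a finite $2$-group acting on $G$ by automorphisms. If $G$ is $d$-maximal for $A$-subgroups, then $\gamma_3(G)=\gamma_2(G)^{2}$.
   Context: All groups are finite. For a finite $p$-group $G$, $d(G)$ denotes the minimal number of generators of $G$. If a group $A$ acts on $G$ (by automorphisms), an $A$-subgroup of $G$ is a subgroup of $G$ which is $A$-invariant. The group $G$ is called $d$-maximal for $A$-subgroups if $d(H)<d(G)$ for every proper $A$-subgroup $H$ of $G$. $(\gamma_n(G))_{n\geq 1}$ is the lower central series of $G$, with $\gamma_1(G)=G$ and $\gamma_{n+1}(G)=[\gamma_n(G),G]$. For a group $X$, $X^{2}$ denotes the subgroup $\langle x^{2}\mid x\in X\rangle$ generated by all squares of elements of $X$. *)

(* Defs.v *)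
From mathcomp Require Import all_boot all_fingroup all_solvable.

Set Implicit Arguments.
Unset Strict Implicit.
Unset Printing Implicit Defensive.

Import GroupScope.

Definition is_Asubgroup (aT rT : finGroupType) (D : {group aT})
    (R : {group rT}) (to : groupAction D R) (A : {group aT})
    (G H : {group rT}) : bool :=
  (H \subset G) && [acts A, on H | to].

Definition d_maximal (aT rT : finGroupType) (D : {group aT})
    (R : {group rT}) (to : groupAction D R) (A : {group aT})
    (G : {group rT}) : Prop :=
  forall H : {group rT},
    is_Asubgroup to A G H -> H \proper G -> 'm(H) < 'm(G).

Definition squares_subgroup (gT : finGroupType) (X : {group gT}) : {set gT} :=
  <<[set x ^+ 2 | x in X]>>.

(* Main.v *)
Require Import Defs.
From mathcomp Require Import all_boot all_fingroup all_solvable.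

Set Implicit Arguments.
Unset Strict Implicit.
Unset Printing Implicit Defensive.

Import GroupScope.

(** Put E = [Phi(G), G].  From [x^2, y] = [x, y]^2 modulo gamma_3(G) one gets
    that E contains both gamma_3(G) and gamma_2(G)^2, so it is enough to see
    that neither is properly contained in E.  If L is one of them and L < E,
    choose M normal in the semidirect product of G by A with L <= M < E and
    |E : M| = 2.  Put H = G/M, F = Phi(H) and K = C_H(F).  As |[F, H]| = 2,
    the commutator pairing gives F <= K and |H : K| <= |F : C_F(H)|, while the
    choice of L (H has class at most 2, or the squares of its commutators are
    trivial) makes the squares of K central, i.e. Phi(K) <= C_F(H).  Hence
    |K : Phi(K)| >= |H : F|, that is d(K) >= d(H) = d(G), and d-maximality
    forces the inverse image of K to be G, against [F, H] <> 1. *)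

(** * Generator numbers and the centraliser of the Frattini subgroup in a 2-group *)

Section FrattiniRank.

Variable gT : finGroupType.
Implicit Types (G H S T : {group gT}).

Lemma Phi_sub_squares G H :
  2.-group G -> G \subset 'N(H) -> {in G, forall x, x ^+ 2 \in H} ->
  'Phi(G) \subset H.
Proof.
move=> pG nHG sqH; apply: Phi_min pG nHG _; apply/exponent2_abelem/exponentP.
by move=> _ /morphimP[x Nx Gx ->]; rewrite -morphX //= coset_id ?sqH.
Qed.

Lemma square_in_Phi G x : 2.-group G -> x \in G -> x ^+ 2 \in 'Phi(G).
Proof.
move=> pG Gx; rewrite (Phi_joing pG) mem_gen // inE orbC.
by rewrite (Mho_p_elt 1) ?(mem_p_elt pG).
Qed.

Lemma der1_sub_Phi (p : nat) G : p.-group G -> G^`(1) \subset 'Phi(G).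
Proof. by move=> pG; rewrite (Phi_joing pG) joing_subl. Qed.

(* Along a chain of maximal subgroups from T to S, each step at least doubles the
   subgroup and at most halves its centraliser in H. *)
Lemma index_cent_leq H S T :
    T \subset S -> H \subset 'C(T) -> {in S, forall x, #|x ^: H| <= 2} ->
  #|H : 'C_H(S)| <= #|S : T|.
Proof.
have [n] := ubnP #|S|; elim: n S => // n IHn S /ltnSE-leSn sTS cTH clS.
have [eqTS|ltTS] := eqVproper sTS; first by rewrite -eqTS (setIidPl cTH) !indexgg.
have [U maxU sTU] : {U : {group gT} | maximal U S & T \subset U}.
  by apply: maxgroup_exists; rewrite ltTS.
have /andP[sUS /subsetPn[x Sx U'x]] := maxgroupp maxU.
have ltUS := maxgroupp maxU.
have defS : U <*> <[x]> = S.
  apply/eqP; rewrite eqEsubset join_subG sUS cycle_subG Sx /=.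
  apply: contraR U'x => not_sSUx; case/maxgroupP: maxU => _ maxU.
  rewrite -cycle_subG -(maxU (U <*> <[x]>)%G) ?joing_subl ?joing_subr //.
  by rewrite properE join_subG sUS cycle_subG Sx.
have sCU : 'C_H(U) \subset H by rewrite subsetIl.
(* As [U] and [x] generate [S], passing from [U] to [S] multiplies the index by the size of the
   class of [x] under ['C_H(U)], at most 2. *)
have -> : 'C_H(S) = 'C_('C_H(U))[x].
  by rewrite -{1}defS centY cent_cycle setIA.
rewrite -(Lagrange_index sUS sTU) mulnC -(Lagrange_index sCU (subsetIl _ _)).
rewrite leq_mul //; last first.
  rewrite index_cent1 (leq_trans _ (_ : 1 < _)) ?indexg_gt1 ?proper_subn //.
  by apply: leq_trans (clS x Sx); rewrite subset_leq_card ?imsetS.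
apply: IHn => //; first exact: leq_trans (proper_card ltUS) leSn.
by move=> y Uy; apply: clS; apply: (subsetP sUS).
Qed.

Lemma commute_in_card2 H x y : #|H| <= 2 -> y \in 'N(H) -> x \in H -> x ^ y = x.
Proof.
move=> leH2 nHy Hx; apply/eqP; apply: contraLR leH2 => xyNx; rewrite -ltnNge.
have xN1 : x != 1 by apply: contraNneq xyNx => ->; rewrite conj1g.
apply: leq_trans (subset_leq_card (_ : [set x ^ y; x; 1] \subset H)).
  by rewrite -setUA cardsU1 cards2 !inE negb_or xyNx conjg_eq1 xN1.
by apply/subsetP=> z /[!inE] /orP[/orP[]|] /eqP-> //; rewrite memJ_norm.
Qed.

(** Burnside's basis theorem: a minimal generating set of the elementary abelian group [G / 'Phi(G)]
    lifts to a generating set of [G]. *)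
Lemma grank_Phi (p : nat) G :
  prime p -> p.-group G -> (p ^ 'm(G))%N = #|G : 'Phi(G)|.
Proof.
move=> p_pr pG; have nPhi : G \subset 'N('Phi(G)) := gFnorm _ _.
have abelGb := Phi_quotient_abelem pG; have [pGb cGb _] := and3P abelGb.
rewrite -card_quotient // (card_pgroup pGb) -rank_abelem -?grank_abelian //.
congr (p ^ _)%N; apply/eqP; rewrite eqn_leq quotient_grank // andbT.
have [/= Xb defGb <-] := grank_witness (G / 'Phi(G)).
pose X := (repr \o val : coset_of 'Phi(G) -> gT) @: Xb.
have sXG : X \subset G.
  apply/subsetP=> x; case/imsetP=> xb Xxb ->; have nPx := repr_coset_norm xb.
  rewrite -sub1set -(quotientSGK _ (Phi_sub G)) ?sub1set ?quotient_set1 //= sub1set.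
  by rewrite coset_reprK -defGb mem_gen.
have nPX := subset_trans sXG nPhi.
have defG : <<X>> = G.
  apply: Phi_nongen; apply/eqP; rewrite eqEsubset join_subG Phi_sub sXG -joing_idr.
  rewrite -genM_join sub_gen // -quotientSK ?quotient_gen // -defGb genS //.
  apply/subsetP=> xb Xxb; apply/imsetP; rewrite (setIidPr nPX).
  by exists (repr xb); rewrite /= ?coset_reprK //; apply: imset_f.
by rewrite -[in leqLHS]defG (leq_trans (grank_min _)) ?leq_imset_card.
Qed.

(** The disjunction lets one lemma serve both quotients: commutators of trivial square, and class at
    most 2. *)
Lemma grank_leq_cent_Phi G :
    2.-group G -> #|[~: 'Phi(G), G]| <= 2 ->
    {in G &, forall x y, [~ x, y] ^+ 2 = 1 \/ [~ x, y, y] = 1} ->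
  'm(G) <= 'm('C_G('Phi(G))).
Proof.
move=> pG leE2 sqG; set F := 'Phi(G); set K := 'C_G(F).
have sFG : F \subset G := Phi_sub G.
have nFG : G \subset 'N(F) := gFnorm _ _.
have sR f y : f \in F -> y \in G -> [~ f, y] \in [~: F, G] by exact: mem_commg.
(* A normal subgroup of order at most 2 is central. *)
have cE : G \subset 'C([~: F, G]).
  apply/centsP=> y Gy z Ez; apply/commute_sym/commgP/conjg_fixP.
  apply: commute_in_card2 leE2 _ Ez.
  by apply: subsetP Gy; rewrite normsR ?normG.
have E2 z : z \in [~: F, G] -> z ^+ 2 = 1.
  move=> Ez; apply/eqP; rewrite -order_dvdn (dvdn_trans (order_dvdG Ez)) //.
  by case: #|_| (cardG_gt0 [~: F, G]) leE2 => [|[|[|]]].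
(* Since [[~ f, y]] is central, [[~ f, y ^+ 2]] equals [[~ f, y] ^+ 2], which is 1. *)
have FG2 f y : f \in F -> y \in G -> commute f (y ^+ 2).
  move=> Ff Gy; apply/commgP/eqP; rewrite commgX ?E2 ?sR //.
  by apply: (centsP cE); rewrite ?sR.
have sFK : F \subset K.
  apply: Phi_sub_squares => // [|x Gx]; first by rewrite normsI ?normG ?norms_cent.
  rewrite inE groupX //; apply/centP=> f Ff; exact/commute_sym/FG2.
have sKZ : 'Phi(K) \subset 'C_F(G).
  apply: Phi_sub_squares => [||x].
  - exact: pgroupS (subsetIl _ _) pG.
  - by rewrite cents_norm // centsC (subset_trans (subsetIr _ _)) ?centS ?subsetIl.
  case/setIP=> Gx cFx; rewrite inE square_in_Phi //; apply/centP=> y Gy.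
  have Fxy : [~ x, y] \in F by rewrite (subsetP (der1_sub_Phi pG)) ?mem_commg.
  (* As [x] centralises [y ^+ 2], the product of [[~ x, y] ^+ 2] and [[~ x, y, y]] is 1, so either
     alternative gives the claim. *)
  have xy2 : [~ x, y] ^+ 2 = 1.
    have : [~ x, y ^+ 2] = 1.
      by apply/eqP/commgP; apply: (centP cFx); apply: square_in_Phi.
    rewrite expgS expg1 commgMR -expg2 => xyy.
    by case: (sqG x y Gx Gy) => // xyy1; rewrite xyy1 mulg1 in xyy.
  apply/commgP/eqP; rewrite commXg //.
  exact: (centP cFx).
(* The class of [f] under [G] lies in the coset of [[~: F, G]] through [f]. *)
have le_idx : #|G : K| <= #|F : 'C_F(G)|.
  apply: index_cent_leq => [||f Ff]; first exact: subsetIl.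
    by rewrite centsC subsetIr.
  apply: leq_trans leE2; rewrite -(card_lcoset [~: F, G] f) subset_leq_card //.
  apply/subsetP=> _ /imsetP[y Gy ->]; rewrite mem_lcoset; exact: sR.
(* In powers of 2: |G : F| = |G : K| |K : F| <= |F : C_F(G)| |K : F| = |K : C_F(G)| <= |K :
   Phi(K)|. *)
rewrite -(leq_exp2l (m := 2)) // !grank_Phi //; last first.
  exact: pgroupS (subsetIl _ _) pG.
rewrite -(Lagrange_index (subsetIl G _) sFK).
rewrite (leq_trans (leq_mul le_idx (leqnn _))) //.
by rewrite mulnC (Lagrange_index sFK (subsetIl _ _)) dvdn_leq // indexgS.
Qed.

End FrattiniRank.

(** * Normal subgroups of a 2-group on which d-maximality is tested by normal subgroups *)

Section NormalDMaximal.

Variable gT : finGroupType.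
Implicit Types (G H K L M P : {group gT}).

Lemma grank_quotient_Phi (p : nat) G M :
  prime p -> p.-group G -> M <| G -> M \subset 'Phi(G) -> 'm(G / M) = 'm(G).
Proof.
move=> p_pr pG nsMG sMPhi; have [sMG nMG] := andP nsMG.
apply/eqP; rewrite -(eqn_exp2l _ _ (prime_gt1 p_pr)) (grank_Phi p_pr pG).
rewrite (grank_Phi p_pr (quotient_pgroup M pG)).
rewrite -(quotient_Phi pG) // index_quotient_eq ?Phi_sub //.
exact: subset_trans (subsetIr _ _) sMPhi.
Qed.

Lemma normal_index_p_between (p : nat) P L H :
    prime p -> p.-group P -> L <| P -> H <| P -> L \proper H ->
  exists M, [/\ M <| P, L \subset M, M \subset H & #|H : M| = p].
Proof.
move=> p_pr pP nsLP nsHP ltLH; have [sHP nHP] := andP nsHP.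
have sLH := proper_sub ltLH; have nLH := subset_trans sHP (normal_norm nsLP).
have pHb : p.-group (H / L) by rewrite quotient_pgroup ?(pgroupS sHP).
(* A normal subgroup of a p-group contains normal subgroups of the whole group of every smaller
   p-power order; the predecessor gives index [p]. *)
have [|Q [sQH nsQP oQ]] := @normal_pgroup p _ (logn p #|H / L|).-1 _ _
  (quotient_pgroup L pP) (quotient_normal L nsHP); first exact: leq_pred.
have [M defQ sLM nsMP] := inv_quotientN nsLP nsQP.
have sMH : M \subset H.
  rewrite -(quotientSGK _ sLH) -?defQ //.
  exact: subset_trans (normal_sub nsMP) (normal_norm nsLP).
exists M; split=> //; apply/eqP.
rewrite -(index_quotient_eq _ sMH nLH) ?(subset_trans (subsetIr _ _)) // -defQ.
rewrite -divgS // oQ [X in X %/ _](card_pgroup pHb).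
have: 0 < logn p #|H / L|.
  rewrite lt0n; apply: contraTneq ltLH => logHL0; rewrite properE sLH.
  by rewrite -quotient_sub1 // subG1 trivg_card1 (card_pgroup pHb) logHL0.
by case: (logn _ _) => // n _; rewrite expnS mulnK // expn_gt0 prime_gt0.
Qed.

Lemma comm_Phi_sub P G L :
    2.-group P -> G <| P ->
    (forall H, H <| P -> H \proper G -> 'm(H) < 'm(G)) ->
    L <| P -> L \subset [~: 'Phi(G), G] ->
    {in G &, forall x y, [~ x, y] ^+ 2 \in L \/ [~ x, y, y] \in L} ->
  [~: 'Phi(G), G] \subset L.
Proof.
move=> pP nsGP dmaxG nsLP sLE sqG; have [sGP nGP] := andP nsGP.
have pG := pgroupS sGP pP; have sFG := Phi_sub G.
have nsFP : 'Phi(G) <| P by rewrite gFnormal_trans.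
have nsEP : [~: 'Phi(G), G] <| P.
  by rewrite /normal normsR ?normal_norm // comm_subG ?normal_sub.
have sEF : [~: 'Phi(G), G] \subset 'Phi(G) by rewrite commg_subl gFnorm.
have [<-//|ltLE] := eqVproper sLE.
have [M [nsMP sLM sME iEM]] :=
  normal_index_p_between (isT : prime 2) pP nsLP nsEP ltLE.
have sMG := subset_trans sME (subset_trans sEF sFG).
have nMG := subset_trans sGP (normal_norm nsMP).
have nMF := subset_trans sFG nMG.
have defPhi : 'Phi(G / M) = 'Phi(G) / M by rewrite (quotient_Phi pG).
have nMP := normal_norm nsMP.
have nsCP : 'C_(G / M)('Phi(G / M)) <| P / M.
  rewrite /normal subIset ?quotientS //= normsI ?quotient_norms // norms_cent //.
  by rewrite defPhi quotient_norms ?normal_norm.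
have [K defK sMK nsKP] := inv_quotientN nsMP nsCP.
have sKG : K \subset G.
  rewrite -(quotientSGK _ sMG) -?defK ?subsetIl //.
  exact: subset_trans (normal_sub nsKP) nMP.
have EbM : [~: 'Phi(G / M), G / M] = [~: 'Phi(G), G] / M by rewrite defPhi quotientR.
have le_mGK : 'm(G) <= 'm(K).
  rewrite -(@grank_quotient_Phi 2 G M) ?(subset_trans sME) ?(normalS sMG sGP) //.
  apply: leq_trans (quotient_grank (subset_trans sKG nMG)); rewrite -defK.
  apply: grank_leq_cent_Phi; first exact: quotient_pgroup.
    by rewrite EbM card_quotient ?iEM // comm_subG.
  move=> _ _ /morphimP[x Nx Gx ->] /morphimP[y Ny Gy ->].
  rewrite -!morphR ?groupR //= -morphX ?groupR //=.
  by case: (sqG x y Gx Gy) => /(subsetP sLM) Mxy; [left | right]; apply: coset_id.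
(* If [K] is [G], then ['Phi(G / M)] is central, so [[~: 'Phi(G), G]] lies in [M], against index
   2. *)
have [defKG|ltKG] := eqVproper sKG; last by rewrite leqNgt dmaxG in le_mGK.
suff sEM : [~: 'Phi(G), G] \subset M by rewrite -indexg_eq1 iEM in sEM.
rewrite -quotient_cents2 // centsC -defPhi -[in X in X \subset _]defKG -defK.
exact: subsetIr.
Qed.

Lemma lcn3_Mho P G :
    2.-group P -> G <| P ->
    (forall H, H <| P -> H \proper G -> 'm(H) < 'm(G)) ->
  'L_3(G) = 'Mho^1('L_2(G)).
Proof.
move=> pP nsGP dmaxG; have [sGP nGP] := andP nsGP; have pG := pgroupS sGP pP.
set E := [~: 'Phi(G), G]; have sPhi := der1_sub_Phi pG.
have sLE : 'L_3(G) \subset E by apply: commSg.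
have pL : 2.-group 'L_2(G) := pgroupS (lcn_sub 2 G) pG.
have L2 x y : x \in G -> y \in G -> [~ x, y] \in 'L_2(G) by exact: mem_commg.
have nEG : G \subset 'N(E) by rewrite normsR ?normG ?gFnorm.
have nEL : 'L_2(G) \subset 'N(E) := subset_trans (lcn_sub 2 G) nEG.
(* This quotient is abelian and generated by images of commutators, whose squares are shown to be
   trivial. *)
have abLE : 2.-abelem ('L_2(G) / E).
  have cLE : abelian ('L_2(G) / E).
    by rewrite /abelian quotient_cents2 // (subset_trans _ sLE) // commgS ?lcn_sub.
  have pLE : 2.-group ('L_2(G) / E) := quotient_pgroup _ pL.
  apply: abelemS (Ohm1_abelem pLE cLE).
  rewrite sub_morphim_pre //.
  change (<<commg_set G G>> \subset coset E @*^-1 'Ohm_1('L_2(G) / E)).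
  rewrite gen_subG.
  apply/subsetP=> _ /imset2P[x y Gx Gy ->]; have Lxy := L2 x y Gx Gy.
  have nExy := subsetP nEL _ Lxy.
  rewrite mem_morphpre //= (OhmE 1 pLE) mem_gen // !inE mem_quotient //=.
  rewrite -morphX //= coset_id //.
  (* This commutator is [[~ x, y] * [~ x, y, x] * [~ x, y]]; moved to the right, the middle factor
     becomes a conjugate lying in [E]. *)
  have : [~ x ^+ 2, y] \in E by rewrite mem_commg ?square_in_Phi.
  rewrite expgS expg1 commMgR -mulgA (conjgC [~ x, y, x]) mulgA groupMr //.
  by rewrite memJ_norm // (subsetP sLE) ?mem_commg ?L2.
have sSE : 'Mho^1('L_2(G)) \subset E.
  by rewrite (subset_trans _ (Phi_min pL nEL abLE)) // (Phi_joing pL) joing_subr.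
have sES : E \subset 'Mho^1('L_2(G)).
  apply: (comm_Phi_sub (L := 'Mho^1('L_2(G))%G)) dmaxG _ _ _ => //.
    exact: char_normal_trans (char_trans (Mho_char _ _) (lcn_char _ _)) nsGP.
  move=> x y Gx Gy; left.
  by rewrite (Mho_p_elt 1) ?L2 // (mem_p_elt pL) ?L2.
have sEL : E \subset 'L_3(G).
  apply: (comm_Phi_sub (L := 'L_3(G)%G)) dmaxG _ _ _ => //.
    exact: char_normal_trans (lcn_char _ _) nsGP.
  by move=> x y Gx Gy; right; rewrite mem_commg ?L2.
by apply/eqP; rewrite eqEsubset (subset_trans sLE) // (subset_trans sSE).
Qed.

End NormalDMaximal.

(** * Passage from the action of [A] to the semidirect product *)

Theorem theorem1p5 (aT gT : finGroupType) (A : {group aT}) (G : {group gT})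
    (to : groupAction A G) :
  2.-group G -> 2.-group A -> d_maximal to A G ->
  'L_3(G) = squares_subgroup 'L_2(G)%G.
Proof.
move=> pG pA dmaxG; pose f := sdpair1_morphism to.
have injf : 'injm f := injm_sdpair1 to.
have defP := sdprod_sdpair to; have [nsfGP _ _ nfGA _] := sdprod_context defP.
have pP : 2.-group [set: sdprod_by to].
  by rewrite /pgroup -(sdprod_card defP) pnatM -!/(pgroup _ _) !morphim_pgroup.
(* A normal subgroup inside the image of [G] is normalised by the image of [A], so its preimage is
   an [A]-subgroup with the same generator number. *)
have dmaxfG (H : {group sdprod_by to}) :
    H <| [set: sdprod_by to] -> H \proper f @* G -> 'm(H) < 'm(f @* G).
  move=> nsH /andP[sHfG not_sfGH]; pose K := (f @*^-1 H)%G.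
  have defH : f @* K = H by rewrite morphpreK // (subset_trans sHfG) ?morphimS.
  have sKG : K \subset G by rewrite subsetIl.
  rewrite -defH !injm_grank //; apply: dmaxG.
    rewrite /is_Asubgroup sKG actsEsd // defH.
    exact: subset_trans (subsetT _) (normal_norm nsH).
  by rewrite properE sKG; apply: contra not_sfGH => sGK; rewrite -defH morphimS.
rewrite /squares_subgroup -(MhoE 1 (pgroupS (lcn_sub 2 G) pG)).
apply: (injm_morphim_inj injf); rewrite ?lcn_sub ?gFsub_trans ?lcn_sub //.
by rewrite morphim_Mho ?lcn_sub // !morphim_lcn // (lcn3_Mho pP nsfGP dmaxfG).
Qed.
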